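(* For every $p\in(1,\infty)$ there exist constants $0<c_p\le C_p<\infty$ (depending only on $p$) such that for every real-valued martingale $(X_n)_{n=1}^{\infty}$, $$c_p^p\,\mathbb{E}\,(X_n^{*})^{p}\le \mathbb{E}\, S_n(X)^p\le C_p^p\,\mathbb{E}\,(X_n^{*})^{p},\qquad n=1,2,\ldots,$$ where $X_n^*=\max_{1\le j\le n}|X_j|$, $S_n(X)=\bigl(\sum_{j=1}^{n}(\Delta X_j)^2\bigr)^{1/2}$, $\Delta X_n=X_n-X_{n-1}$ for $n\ge 1$, and $X_0=0$.
   Context: The martingale $(X_n)_{n=1}^\infty$ is in discrete time, on an arbitrary probability space and with respect to an arbitrary filtration $(\mathcal{F}_n)_{n=1}^{\infty}$. By the convention $X_0=0$ we have $\Delta X_1=X_1$; the variable $X_1$ is not assumed to have mean zero. The expectations in the inequality are of nonnegative random variables and take values in $[0,\infty]$. *)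

(* Defs.v *)
From HB Require Import structures.
From mathcomp Require Import all_boot all_order all_algebra.
From mathcomp Require Import all_classical all_reals all_analysis.

Set Implicit Arguments.
Unset Strict Implicit.
Unset Printing Implicit Defensive.

Import Order.TTheory GRing.Theory Num.Theory.
Import numFieldNormedType.Exports.

Local Open Scope classical_set_scope.
Local Open Scope ring_scope.

(* Time runs over n = 1, 2, ...; the predicates below say nothing about the
   values at index 0. *)

Definition filtration d (T : measurableType d) (F : nat -> set (set T)) :=
  forall n, (1 <= n)%N ->
    [/\ sigma_algebra setT (F n), F n `<=` measurable & F n `<=` F n.+1].

(* For a sigma-algebra G, the measurable sets of [g_sigma_algebraType G] are
   exactly the members of G ([sigma_algebra_id]). *)
Definition measurable_wrt d (T : measurableType d) (R : realType)
    (G : set (set T)) (Y : T -> R) :=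
  measurable_fun (setT : set (g_sigma_algebraType G)) Y.

(* Y is a version of the conditional expectation of Z given G. *)
Definition is_cond_expectation d (T : measurableType d) (R : realType)
    (P : probability T R) (G : set (set T)) (Z Y : T -> R) :=
  [/\ measurable_wrt G Y,
      P.-integrable setT (EFin \o Y) &
      forall A, G A ->
        (\int[P]_(t in A) (Y t)%:E = \int[P]_(t in A) (Z t)%:E)%E].

Definition martingale d (T : measurableType d) (R : realType)
    (P : probability T R) (F : nat -> set (set T)) (X : nat -> T -> R) :=
  forall n, (1 <= n)%N ->
    [/\ measurable_wrt (F n) (X n),
        P.-integrable setT (EFin \o X n) &
        is_cond_expectation P (F n) (X n.+1) (X n)].

(* The default value 0 of the iterated maximum is harmless for n >= 1, the
   terms being nonnegative. *)
Definition max_fun (T : Type) (R : realType) (X : nat -> T -> R) (n : nat)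
    (t : T) : R :=
  \big[Num.max/0]_(1 <= j < n.+1) `|X j t|.

(* Used for j >= 1 only. *)
Definition increment (T : Type) (R : realType) (X : nat -> T -> R) (j : nat)
    (t : T) : R :=
  X j t - X j.-1 t.

Definition square_fun (T : Type) (R : realType) (X : nat -> T -> R) (n : nat)
    (t : T) : R :=
  Num.sqrt (\sum_(1 <= j < n.+1) increment X j t ^+ 2).

(* Main.v *)
Require Import Defs.
From mathcomp Require Import all_boot all_order all_algebra.
From mathcomp Require Import all_classical all_reals all_analysis.
From mathcomp Require Import measurable_realfun ring lra.

Set Implicit Arguments.
Unset Strict Implicit.
Unset Printing Implicit Defensive.

Import Order.TTheory GRing.Theory Num.Theory.
Import numFieldNormedType.Exports.

Local Open Scope classical_set_scope.
Local Open Scope ring_scope.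

(** The Burkholder-Davis-Gundy inequality for p > 1, by the pathwise method of
    Beiglboeck and Siorpaes combined with the Garsia-Neveu argument.

    Let m_n be the running maximum of |X|, s_n the square function and
    r_n = sqrt (m_n^2 + s_n^2).  The identity
    2 x d = (x + d)^2 - x^2 - d^2 shows that the martingale transform
    sum_k (X_k / r_k) (X_(k+1) - X_k) compares the growth of m_n^2 with that of
    s_n^2, both measured in units of r_n; summing over time gives, for every
    path starting at 0 and without any probability ([square_pathwise],
    [max_pathwise]),
      s_n <= 7 m_n - transform    and    m_n <= 11 s_n + 2 transform.
    The weights X_k / r_k are adapted and bounded by 1, so the transform has
    mean zero, and these are already the inequalities for p = 1.

    To reach p > 1 the pathwise inequalities are applied to the path restarted
    at each time i.  With (A, B) = (s, m) or (m, s) this bounds the remaining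
    growth A_n - A_i by a multiple of B_n plus a transform that only involves
    increments after time i ([square_growth], [max_growth]).  Multiplying by
    the nonnegative weight A_(i+1)^(p-1) - A_i^(p-1) and summing over i turns
    the left-hand side, by parts and by convexity, into at least A_n^p / p and
    the first term on the right into a multiple of B_n A_n^(p-1), which Young's
    inequality absorbs ([powR_growth]):
      A_n^p <= C^p B_n^p + (a sum of martingale transforms).
    The restarted weights vanish at their starting time, so the weight indexed
    by i + 1 is known before every increment that it multiplies.  If B_n^p is
    integrable then so are all these transforms, because every increment and
    A_n are dominated by multiples of B_n; their expectations vanish
    ([centered_transform]) and integrating gives the result
    ([moment_transfer]).  If B_n^p is not integrable there is nothing to
    prove. *)

(** * One step of a path *)

Lemma divr_bounds_of_sqr (R : realType) (a b : R) :
  0 <= b -> 0 <= a -> a <= b ^+ 2 -> 0 <= a / b <= b.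
Proof.
move=> b0 a0 ab; rewrite divr_ge0//=.
have [->|bn0] := eqVneq b 0; first by rewrite invr0 mulr0.
by rewrite ler_pdivrMr ?lt_def ?bn0// -expr2.
Qed.

(* A path at x, with running maximum m, square function s and radius
   r = sqrt (m^2 + s^2), makes a step d; primes denote the new values. *)
Section one_step.
Variable R : realType.
Variables (x d m s r m' s' r' : R).
Hypotheses (xm : `|x| <= m) (s0 : 0 <= s) (s'0 : 0 <= s').
Hypotheses (r0 : 0 <= r) (r'0 : 0 <= r').
Hypothesis m'E : m' = Num.max m `|x + d|.
Hypothesis s'E : s' ^+ 2 = s ^+ 2 + d ^+ 2.
Hypothesis rE : r ^+ 2 = m ^+ 2 + s ^+ 2.
Hypothesis r'E : r' ^+ 2 = m' ^+ 2 + s' ^+ 2.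

Let gap := m ^+ 2 - x ^+ 2.
Let gap' := m' ^+ 2 - (x + d) ^+ 2.

Let m0 : 0 <= m. Proof. exact: le_trans xm. Qed.

Let le_mm' : m <= m'. Proof. by rewrite m'E le_max lexx. Qed.

Let m'0 : 0 <= m'. Proof. exact: le_trans m0 le_mm'. Qed.

Let le_m'm : m' <= m + `|d|.
Proof.
rewrite m'E ge_max lerDl normr_ge0/=; apply: le_trans (ler_normD _ _) _.
by rewrite lerD2r.
Qed.

Let jump_le : `|d| <= m' + m.
Proof.
have -> : d = (x + d) - x by ring.
by apply: le_trans (ler_normB _ _) _; rewrite lerD// m'E le_max lexx orbT.
Qed.

Let le_sqr (a b : R) : 0 <= a -> 0 <= b -> a ^+ 2 <= b ^+ 2 -> a <= b.
Proof. by move=> a0 b0; rewrite ler_sqr. Qed.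

Let normd2 : `|d| ^+ 2 = d ^+ 2. Proof. by rewrite real_normK ?num_real. Qed.

Let le_ss' : s <= s'.
Proof. by apply: le_sqr => //; rewrite s'E lerDl sqr_ge0. Qed.

Let le_s's : s' <= s + `|d|.
Proof.
apply: le_sqr; rewrite ?addr_ge0// s'E sqrrD normd2.
by rewrite -subr_ge0 [leRHS](_ : _ = s * `|d| *+ 2) ?mulrn_wge0 ?mulr_ge0//; ring.
Qed.

Let le_ds' : `|d| <= s'.
Proof. by apply: le_sqr => //; rewrite s'E normd2 lerDr sqr_ge0. Qed.

Let le_mr : m <= r.
Proof. by apply: le_sqr => //; rewrite rE lerDl sqr_ge0. Qed.

Let le_sr : s <= r.
Proof. by apply: le_sqr => //; rewrite rE lerDr sqr_ge0. Qed.

Let le_rr' : r <= r'.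
Proof. by apply: le_sqr => //; rewrite rE r'E lerD// ler_sqr ?nnegrE. Qed.

(* The Euclidean norm is 1-Lipschitz for the l^1 norm. *)
Let le_r'r : r' - r <= (m' - m) + (s' - s).
Proof.
rewrite lerBlDl; apply: le_sqr => //.
  by rewrite addr_ge0 ?subr_ge0// addr_ge0// subr_ge0.
have a0 : 0 <= m' - m by rewrite subr_ge0.
have b0 : 0 <= s' - s by rewrite subr_ge0.
have : 0 <= (m' - m) * (r - m) by rewrite mulr_ge0// subr_ge0.
have : 0 <= (s' - s) * (r - s) by rewrite mulr_ge0// subr_ge0.
have := mulr_ge0 a0 b0.
have := rE; have := r'E; lra.
Qed.

Let gap_ge0 : 0 <= gap.
Proof. by rewrite subr_ge0 -(real_normK (num_real x)) ler_sqr ?nnegrE. Qed.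

Let gap'_ge0 : 0 <= gap'.
Proof.
rewrite subr_ge0 -(real_normK (num_real (x + d))) ler_sqr ?nnegrE//.
by rewrite m'E le_max lexx orbT.
Qed.

Let gap_ratio : 0 <= gap / r <= r.
Proof.
apply: divr_bounds_of_sqr => //; rewrite rE /gap lerD//.
by rewrite (le_trans _ (sqr_ge0 _))// oppr_le0 sqr_ge0.
Qed.

Let gap'_ratio : 0 <= gap' / r' <= r'.
Proof.
apply: divr_bounds_of_sqr => //; rewrite r'E /gap' lerD//.
by rewrite (le_trans _ (sqr_ge0 _))// oppr_le0 sqr_ge0.
Qed.

Let gain_le : - `|d| <= x / r * d <= `|d|.
Proof.
rewrite -ler_norml normrM -[leRHS]mul1r ler_wpM2r//.
have [->|rn0] := eqVneq r 0; first by rewrite invr0 mulr0 normr0.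
rewrite normrM normfV (ger0_norm r0) ler_pdivrMr ?lt_def ?rn0// mul1r.
exact: le_trans xm le_mr.
Qed.

(* This is 2 x d = (x + d)^2 - x^2 - d^2. *)
Let gainE : 0 < r ->
  2 * (x / r * d) * r = m' ^+ 2 - gap' - (m ^+ 2 - gap) - d ^+ 2.
Proof.
move=> rp; rewrite -(mulrA 2) (mulrAC _ d r) divfK ?gt_eqF//.
rewrite /gap /gap'; ring.
Qed.

Let radius_growth : 2 * r * (r' - r) <= m' ^+ 2 - m ^+ 2 + d ^+ 2.
Proof.
have := sqr_ge0 (r' - r); have := rE; have := r'E; have := s'E; lra.
Qed.

(** The ratio gap / r makes the comparison telescope: for a step that is small
    compared with r, the multiplication by r and [gainE] reduce the claim to
    2 (m'^2 - m^2) <= 14 r (m' - m), which holds since m' + m is of order r.  A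
    large step makes the maximum itself grow by at least |d| / 2, and this pays
    for all the other terms, which are of order |d|. *)
Lemma square_one_step :
  2 * r' + gap' / r' + 2 * (x / r * d) - 14 * m' <= 2 * r + gap / r - 14 * m.
Proof.
have [big|small] := leP (4 * r) `|d|.
  have := gap_ratio; have := gap'_ratio; have := gain_le.
  move: (gap' / r') (gap / r) (x / r * d) => u' u g.
  move=> /andP[? ?] /andP[? ?] /andP[? ?].
  by have := (jump_le, le_mr, le_s's, le_r'r); move=> [[[]]]; lra.
have rp : 0 < r.
  by rewrite lt_def r0 andbT; apply: contraTneq small => ->; rewrite mulr0 -leNgt.
rewrite -subr_ge0 -(pmulr_rge0 _ rp).
have Ea : gap / r * r = gap by rewrite divfK ?gt_eqF.
have Ea' : gap' / r' * r' = gap' by rewrite divfK ?gt_eqF// (lt_le_trans rp).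
have Eg := gainE rp.
(* Multiplied by r, the new ratio costs at most the new gap. *)
have : gap' / r' * r <= gap' / r' * r'.
  by case/andP: gap'_ratio => u'0 _; rewrite ler_wpM2l.
have : 0 <= (m' - m) * (7 * r - m' - m).
  apply: mulr_ge0; rewrite ?subr_ge0//.
  by have := (le_m'm, le_mr); move=> []; lra.
have := radius_growth.
move: (gap' / r') (gap / r) (x / r * d) Ea Ea' Eg => u' u g; lra.
Qed.

(** Same scheme, with the roles of the maximum and of the square function
    exchanged.  The ratio gap / r now enters with the opposite sign; the error
    gap' (1 / r - 1 / r') that it creates can only be charged to the growth of
    the square function, and it can, because the gap vanishes whenever the
    maximum grows. *)
Lemma max_one_step :
  2 * r' - gap' / r' - 2 * (x / r * d) - 11 * s' <= 2 * r - gap / r - 11 * s.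
Proof.
have [big|small] := leP (3 * r) `|d|.
  have := gap_ratio; have := gap'_ratio; have := gain_le.
  move: (gap' / r') (gap / r) (x / r * d) => u' u g.
  move=> /andP[? ?] /andP[? ?] /andP[? ?].
  by have := (le_m'm, le_sr, le_ds', le_r'r); move=> [[[]]]; lra.
have rp : 0 < r.
  by rewrite lt_def r0 andbT; apply: contraTneq small => ->; rewrite mulr0 -leNgt.
have r'p : 0 < r' by rewrite (lt_le_trans rp).
rewrite -subr_ge0 -(pmulr_rge0 _ rp).
have Ea : gap / r * r = gap by rewrite divfK ?gt_eqF.
have Ea' : gap' / r' * r' = gap' by rewrite divfK ?gt_eqF// (lt_le_trans rp).
have Eg := gainE rp.
have : gap' / r' * (r' - r) <= r * (s' - s).
  have [mx|mx] := leP `|x + d| m.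
    have m'm : m' = m by rewrite m'E; apply/max_idPl.
    case/andP: gap'_ratio => u'0 _; apply: ler_pM => //; rewrite ?subr_ge0//.
      rewrite ler_pdivrMr// (@le_trans _ _ (r * r))//; last by rewrite ler_pM2l.
      rewrite /gap' m'm -expr2 rE lerD// (le_trans _ (sqr_ge0 _))//.
      by rewrite oppr_le0 sqr_ge0.
    by apply: le_trans le_r'r _; rewrite m'm subrr add0r.
  have m'x : m' = `|x + d| by rewrite m'E; apply/max_idPr/ltW.
  by rewrite /gap' m'x real_normK ?num_real// subrr !mul0r mulr_ge0// subr_ge0.
have : 0 <= (s' - s) * (5 * r - s' - s).
  apply: mulr_ge0; rewrite ?subr_ge0//.
  by have := (le_s's, le_sr); move=> []; lra.
have := (radius_growth, s'E).
move: (gap' / r') (gap / r) (x / r * d) Ea Ea' Eg => u' u g ? ? ? []; lra.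
Qed.

End one_step.

(** * Pathwise inequalities *)

Section paths.
Variables (T : Type) (R : realType).
Implicit Types (X Y : nat -> T -> R) (t : T).

Lemma max_fun0 X t : max_fun X 0 t = 0.
Proof. by rewrite /max_fun big_nil. Qed.

Lemma max_funS X n t : max_fun X n.+1 t = Num.max (max_fun X n t) `|X n.+1 t|.
Proof.
rewrite /max_fun /index_iota !subn1 [n.+2.-1]/= -[in iota _ _](addn1 n) iotaD.
rewrite add1n cats1 big_rcons_op/=; move: (iota 1 n) (0 : R) => s; elim: s => [|j s IHs] a; first by rewrite !big_nil maxC.
by rewrite !big_cons IHs maxA.
Qed.

Lemma max_fun_ge0 X n t : 0 <= max_fun X n t.
Proof.
by elim: n => [|n IHn]; rewrite ?max_fun0// max_funS le_max IHn.
Qed.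

Lemma max_fun_homo X t : {homo (max_fun X)^~ t : i j / (i <= j)%N >-> i <= j}.
Proof.
by apply: homo_leq => // [? ? ?|i]; [exact: le_trans|rewrite max_funS le_max lexx].
Qed.

Lemma le_max_fun X j n t : (0 < j <= n)%N -> `|X j t| <= max_fun X n t.
Proof.
case: j => // j /= jn; apply: le_trans (max_fun_homo X t jn).
by rewrite max_funS le_max lexx orbT.
Qed.

Lemma square_fun0 X t : square_fun X 0 t = 0.
Proof. by rewrite /square_fun big_nil sqrtr0. Qed.

Lemma square_fun_ge0 X n t : 0 <= square_fun X n t.
Proof. exact: sqrtr_ge0. Qed.

Lemma square_funS X n t :
  square_fun X n.+1 t ^+ 2 = square_fun X n t ^+ 2 + increment X n.+1 t ^+ 2.
Proof.
have sum0 k : 0 <= \sum_(1 <= j < k) increment X j t ^+ 2.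
  by apply: sumr_ge0 => j _; exact: sqr_ge0.
by rewrite /square_fun !sqr_sqrtr// big_nat_recr.
Qed.

Lemma square_fun_homo X t :
  {homo (square_fun X)^~ t : i j / (i <= j)%N >-> i <= j}.
Proof.
apply: homo_leq => // [? ? ?|i]; first exact: le_trans.
by rewrite -ler_sqr ?nnegrE ?square_fun_ge0// square_funS lerDl sqr_ge0.
Qed.

Lemma increment_le_square X j n t : (0 < j <= n)%N ->
  `|increment X j t| <= square_fun X n t.
Proof.
case: j => // j /= jn; apply: le_trans (square_fun_homo X t jn).
rewrite -ler_sqr ?nnegrE ?square_fun_ge0// square_funS.
by rewrite real_normK ?num_real// lerDr sqr_ge0.
Qed.

Lemma increment_le_max X j n t : X 0%N t = 0 -> (0 < j <= n)%N ->
  `|increment X j t| <= 2 * max_fun X n t.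
Proof.
move=> X0; case: j => // j /= jn.
rewrite mulrDl !mul1r; apply: le_trans (ler_normB _ _) _.
apply: lerD; first exact: le_max_fun.
case: j jn => [|j] jn; last by rewrite le_max_fun//= ltnW.
by rewrite /= X0 normr0 max_fun_ge0.
Qed.

(** The factor n is crude, but only the domination of the maximum by the
    increments matters: it gives integrability, never a constant. *)
Lemma max_fun_le X n t (c : R) : X 0%N t = 0 ->
  (forall j, (0 < j <= n)%N -> `|increment X j t| <= c) ->
  max_fun X n t <= n%:R * c.
Proof.
move=> X0; elim: n => [|n IHn] Xc; first by rewrite max_fun0 mul0r.
have c0 : 0 <= c by apply: le_trans (Xc n.+1 _); rewrite //= leqnn.
have {}IHn : max_fun X n t <= n%:R * c.
  by apply: IHn => j /andP[j0 jn]; apply: Xc; rewrite j0 ltnW.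
rewrite max_funS ge_max -natr1 mulrDl mul1r; apply/andP; split.
  by apply: le_trans IHn _; rewrite lerDl.
have -> : X n.+1 t = X n t + increment X n.+1 t by rewrite /increment/= addrC subrK.
apply: le_trans (ler_normD _ _) _; apply: lerD; last by apply: Xc; rewrite //= leqnn.
apply: le_trans IHn; case: n {Xc} => [|n]; last by rewrite le_max_fun/=.
by rewrite X0 normr0 max_fun0.
Qed.

Lemma square_fun_le X n t (c : R) :
  (forall j, (0 < j <= n)%N -> `|increment X j t| <= c) ->
  square_fun X n t <= n%:R * c.
Proof.
elim: n => [|n IHn] Xc; first by rewrite square_fun0 mul0r.
have c0 : 0 <= c by apply: le_trans (Xc n.+1 _); rewrite //= leqnn.
have {}IHn : square_fun X n t <= n%:R * c.
  by apply: IHn => j /andP[j0 jn]; apply: Xc; rewrite j0 ltnW.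
have := Xc n.+1; rewrite leqnn => /(_ isT) Xn.
rewrite -ler_sqr ?nnegrE ?square_fun_ge0 ?mulr_ge0// square_funS.
rewrite -natr1 mulrDl mul1r [leRHS]sqrrD -[leRHS]addrA; apply: lerD.
  by rewrite ler_sqr ?nnegrE ?square_fun_ge0 ?mulr_ge0.
rewrite ler_wpDl ?mulrn_wge0 ?mulr_ge0//.
by rewrite -(real_normK (num_real (increment _ _ _))) ler_sqr ?nnegrE.
Qed.

Definition restart X i : nat -> T -> R := fun l t => X (i + l)%N t - X i t.

Lemma restart0 X i t : restart X i 0%N t = 0.
Proof. by rewrite /restart addn0 subrr. Qed.

Lemma increment_restart X i l t :
  increment (restart X i) l.+1 t = increment X (i + l).+1 t.
Proof. by rewrite /increment /restart/= addnS/=; ring. Qed.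

Lemma square_restart X i l t :
  square_fun X (i + l) t ^+ 2 =
  square_fun X i t ^+ 2 + square_fun (restart X i) l t ^+ 2.
Proof.
elim: l => [|l IHl]; first by rewrite addn0 square_fun0 expr0n/= addr0.
by rewrite addnS !square_funS IHl increment_restart addrA.
Qed.

Lemma square_restart_le X i l t :
  square_fun (restart X i) l t <= square_fun X (i + l) t.
Proof.
by rewrite -ler_sqr ?nnegrE ?square_fun_ge0// square_restart lerDr sqr_ge0.
Qed.

Lemma square_le_restart X i l t :
  square_fun X (i + l) t <= square_fun X i t + square_fun (restart X i) l t.
Proof.
rewrite -ler_sqr ?nnegrE ?addr_ge0 ?square_fun_ge0// square_restart sqrrD.
rewrite lerD2r lerDl mulrn_wge0// mulr_ge0 ?square_fun_ge0//.
Qed.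

Lemma norm_le_max_fun X i n t : X 0%N t = 0 -> (i <= n)%N -> `|X i t| <= max_fun X n t.
Proof.
by move=> X0; case: i => [|i] ?; [rewrite X0 normr0 max_fun_ge0|exact: le_max_fun].
Qed.

Lemma max_restart_le X i l t : X 0%N t = 0 ->
  max_fun (restart X i) l t <= 2 * max_fun X (i + l) t.
Proof.
move=> X0; elim: l => [|l IHl]; first by rewrite max_fun0 mulr_ge0// max_fun_ge0.
rewrite max_funS ge_max; apply/andP; split.
  by apply: le_trans IHl _; rewrite ler_wpM2l// max_fun_homo// leq_add2l.
rewrite mulrDl !mul1r; apply: le_trans (ler_normB _ _) _.
by rewrite lerD// norm_le_max_fun// leq_addr.
Qed.

Lemma max_le_restart X i l t : X 0%N t = 0 ->
  max_fun X (i + l) t <= max_fun X i t + max_fun (restart X i) l t.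
Proof.
move=> X0; elim: l => [|l IHl]; first by rewrite addn0 max_fun0 addr0.
rewrite addnS max_funS ge_max; apply/andP; split.
  by apply: le_trans IHl _; rewrite lerD2l max_fun_homo.
have -> : X (i + l).+1 t = X i t + restart X i l.+1 t.
  by rewrite /restart addnS addrC subrK.
apply: le_trans (ler_normD _ _) _; apply: lerD; last by rewrite le_max_fun/=.
by rewrite norm_le_max_fun// leq_addr.
Qed.

(** The maximum is included in the radius so that the weight is bounded by 1;
    the square function, so that the radius controls the size of earlier steps
    as well. *)
Definition path_radius X n t : R :=
  Num.sqrt (max_fun X n t ^+ 2 + square_fun X n t ^+ 2).

Definition weight X n t : R := X n t / path_radius X n t.

Lemma path_radius_ge0 X n t : 0 <= path_radius X n t. Proof. exact: sqrtr_ge0. Qed.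

Lemma path_radius_sqr X n t :
  path_radius X n t ^+ 2 = max_fun X n t ^+ 2 + square_fun X n t ^+ 2.
Proof. by rewrite sqr_sqrtr// addr_ge0// sqr_ge0. Qed.

Lemma max_le_radius X n t : max_fun X n t <= path_radius X n t.
Proof.
by rewrite -ler_sqr ?nnegrE ?max_fun_ge0 ?path_radius_ge0// path_radius_sqr lerDl sqr_ge0.
Qed.

Lemma square_le_radius X n t : square_fun X n t <= path_radius X n t.
Proof.
by rewrite -ler_sqr ?nnegrE ?square_fun_ge0 ?path_radius_ge0// path_radius_sqr lerDr sqr_ge0.
Qed.

Lemma weight_le1 X n t : X 0%N t = 0 -> `|weight X n t| <= 1.
Proof.
move=> X0; rewrite /weight; have [->|rn0] := eqVneq (path_radius X n t) 0.
  by rewrite invr0 mulr0 normr0.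
rewrite normrM normfV (ger0_norm (path_radius_ge0 _ _ _)).
rewrite ler_pdivrMr ?lt_def ?rn0 ?path_radius_ge0// mul1r.
by apply: le_trans (max_le_radius _ _ _); exact: norm_le_max_fun.
Qed.

Let gain X n t := \sum_(l < n) weight X l t * increment X l.+1 t.

Let potential X n t := (max_fun X n t ^+ 2 - X n t ^+ 2) / path_radius X n t.

Let potential_bounds X n t : X 0%N t = 0 ->
  0 <= potential X n t <= path_radius X n t.
Proof.
move=> X0; apply: divr_bounds_of_sqr; first exact: path_radius_ge0.
  rewrite subr_ge0 -(real_normK (num_real (X n t))) ler_sqr ?nnegrE ?max_fun_ge0//.
  exact: norm_le_max_fun.
rewrite path_radius_sqr lerD// (le_trans _ (sqr_ge0 _))//.
by rewrite oppr_le0 sqr_ge0.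
Qed.

Let stepE X n t : X n.+1 t = X n t + increment X n.+1 t.
Proof. by rewrite /increment/= addrC subrK. Qed.

(** By [square_one_step] the quantity bounded in the [suff] below decreases along
    the path; it starts at 0. *)
Lemma square_pathwise X n t : X 0%N t = 0 ->
  square_fun X n t <= 7 * max_fun X n t -
    \sum_(l < n) weight X l t * increment X l.+1 t.
Proof.
move=> X0; rewrite -/(gain X n t).
have /andP[pot0 _] := potential_bounds n X0; have sr := square_le_radius X n t.
suff : 2 * path_radius X n t + potential X n t + 2 * gain X n t
       - 14 * max_fun X n t <= 0 by lra.
elim: n {pot0 sr} => [|n].
  rewrite /gain big_ord0 /potential /path_radius max_fun0 square_fun0 X0.
  by rewrite !expr0n/= addr0 sqrtr0 subrr; lra.
apply: le_trans.
have := @square_one_step R (X n t) (increment X n.+1 t) _ _ _ _ _ _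
  (norm_le_max_fun X0 (leqnn n)) (square_fun_ge0 X n t)
  (square_fun_ge0 X n.+1 t) (path_radius_ge0 X n t) (path_radius_ge0 X n.+1 t).
rewrite -stepE => /(_ _ (max_funS _ _ _) (square_funS _ _ _)).
move=> /(_ (path_radius_sqr _ _ _) (path_radius_sqr _ _ _)).
rewrite -/(weight X n t) -/(potential X n t) -/(potential X n.+1 t).
rewrite /gain big_ord_recr/=; lra.
Qed.

(** By [max_one_step], in the same way; here the potential has the unfavourable
    sign, but it takes away at most one of the two copies of the radius. *)
Lemma max_pathwise X n t : X 0%N t = 0 ->
  max_fun X n t <= 11 * square_fun X n t +
    2 * \sum_(l < n) weight X l t * increment X l.+1 t.
Proof.
move=> X0; rewrite -/(gain X n t).
have /andP[_ pot] := potential_bounds n X0; have mr := max_le_radius X n t.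
suff : 2 * path_radius X n t - potential X n t - 2 * gain X n t
       - 11 * square_fun X n t <= 0 by lra.
elim: n {pot mr} => [|n].
  rewrite /gain big_ord0 /potential /path_radius max_fun0 square_fun0 X0.
  by rewrite !expr0n/= addr0 sqrtr0 subrr; lra.
apply: le_trans.
have := @max_one_step R (X n t) (increment X n.+1 t) _ _ _ _ _ _
  (norm_le_max_fun X0 (leqnn n)) (square_fun_ge0 X n t)
  (square_fun_ge0 X n.+1 t) (path_radius_ge0 X n t) (path_radius_ge0 X n.+1 t).
rewrite -stepE => /(_ _ (max_funS _ _ _) (square_funS _ _ _)).
move=> /(_ (path_radius_sqr _ _ _) (path_radius_sqr _ _ _)).
rewrite -/(weight X n t) -/(potential X n t) -/(potential X n.+1 t).
rewrite /gain big_ord_recr/=; lra.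
Qed.

(** The restarted maximum is at most twice the original one, whence 14 = 2 * 7. *)
Lemma square_growth X n i t : X 0%N t = 0 -> (i <= n)%N ->
  square_fun X n t - square_fun X i t <= 14 * max_fun X n t +
    \sum_(l < n - i) - weight (restart X i) l t * increment X (i + l).+1 t.
Proof.
move=> X0 /subnKC ni; have := square_pathwise (n - i) (restart0 X i t).
have := square_le_restart X i (n - i) t; have := max_restart_le i (n - i) X0.
rewrite ni; under eq_bigr do rewrite increment_restart.
under [X in _ -> _ -> _ -> _ <= _ + X]eq_bigr do rewrite mulNr.
rewrite sumrN; lra.
Qed.

Lemma max_growth X n i t : X 0%N t = 0 -> (i <= n)%N ->
  max_fun X n t - max_fun X i t <= 11 * square_fun X n t +
    \sum_(l < n - i) (2 * weight (restart X i) l t) * increment X (i + l).+1 t.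
Proof.
move=> X0 /subnKC ni; have := max_pathwise (n - i) (restart0 X i t).
have := max_le_restart i (n - i) X0; have := square_restart_le X i (n - i) t.
rewrite ni; under eq_bigr do rewrite increment_restart.
under [X in _ -> _ -> _ -> _ <= _ + X]eq_bigr do rewrite -mulrA.
rewrite -mulr_sumr; lra.
Qed.

End paths.

(** * The Garsia-Neveu argument along a path *)

Section garsia.
Variables (R : realType) (p : R).
Hypothesis p1 : 1 < p.

Let p0 : 0 < p. Proof. exact: lt_trans p1. Qed.

Let powRpE (a : R) : 0 <= a -> a `^ p = a `^ (p - 1) * a.
Proof.
move=> a0; rewrite -{3}(powRr1 a0) -powRD ?subrK//.
by rewrite gt_eqF.
Qed.

(** The tangent line inequality for the convex function x^p / p, which is Young's
    inequality for the product b^(p-1) a. *)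
Lemma powR_sub_le (a b : R) : 0 <= a -> 0 <= b ->
  (b `^ p - a `^ p) / p <= b `^ (p - 1) * (b - a).
Proof.
move=> a0 b0; have q0 : 0 < p - 1 by rewrite subr_gt0.
have pn0 : p != 0 by rewrite gt_eqF.
have qn0 : p - 1 != 0 by rewrite gt_eqF.
have := @conjugate_powR R (b `^ (p - 1)) a (p / (p - 1)) p (powR_ge0 _ _) a0.
move=> /(_ (divr_gt0 p0 q0) p0); have -> : (p / (p - 1))^-1 + p^-1 = 1.
  by rewrite invf_div -[X in _ + X]mul1r -mulrDl subrK divff.
move=> /(_ erefl).
rewrite -powRrM [(p - 1) * _]mulrC divfK//.
rewrite invf_div mulrBr -powRpE// => young.
rewrite -(ler_pM2r p0) divfK//.
have : b `^ (p - 1) * a * p <= (b `^ p * ((p - 1) / p) + a `^ p / p) * p by rewrite ler_pM2r.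
rewrite (mulrDl (b `^ p * _)) divfK// -!mulrA mulVf// mulr1.
lra.
Qed.

(** If the sum of the e i, weighted by the increments of a^(p-1), has mean zero,
    this controls the p-th moment of a by that of b.  The constant comes from
    absorbing: 2 p K b a^(p-1) is at most a^p + (2 p K b)^p, according to which
    of a and 2 p K b is larger. *)
Lemma powR_growth (n : nat) (a e : nat -> R) (b K : R) :
  a 0%N = 0 -> {homo a : i j / (i <= j)%N >-> i <= j} -> 0 <= b -> 0 < K ->
  (forall i, (i < n)%N -> a n - a i <= K * b + e i) ->
  a n `^ p <= (2 * p * K) `^ p * b `^ p +
    2 * p * \sum_(i < n) (a i.+1 `^ (p - 1) - a i `^ (p - 1)) * e i.
Proof.
move=> a00 ndec b0 K0 ae; have q0 : 0 < p - 1 by rewrite subr_gt0.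
have a0 i : 0 <= a i by rewrite -a00 ndec.
pose w i := a i.+1 `^ (p - 1) - a i `^ (p - 1).
have w0 i : 0 <= w i.
  by rewrite subr_ge0; apply: ge0_ler_powR; rewrite ?nnegrE ?(ltW q0)// ndec.
(* Summation by parts, and convexity of the p-th power. *)
have lower m : a m `^ (p - 1) * (a n - a m) + a m `^ p / p <= \sum_(i < m) w i * (a n - a i).
  elim: m => [|m IHm].
    by rewrite big_ord0 a00 !powR0 ?gt_eqF// !mul0r addr0.
  rewrite big_ord_recr/= /w; apply: le_trans (lerD IHm (lexx _)).
  have := powR_sub_le (a0 m) (a0 m.+1); lra.
have := lower n; rewrite subrr mulr0 add0r => {}lower.
have upper : \sum_(i < n) w i * (a n - a i) <= a n `^ (p - 1) * (K * b) + \sum_(i < n) w i * e i.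
  apply: (@le_trans _ _ (\sum_(i < n) w i * (K * b + e i))).
    by apply: ler_sum => i _; rewrite ler_wpM2l// ae.
  under eq_bigr do rewrite mulrDr.
  rewrite big_split/= -mulr_suml (_ : \sum_(i < n) w i = a n `^ (p - 1))//.
  rewrite -(big_mkord xpredT w) telescope_sumr// a00 powR0 ?subr0//.
  by rewrite gt_eqF.
have pK0 : 0 <= 2 * p * K by rewrite !mulr_ge0 ?ltW.
have split_power : a n `^ (p - 1) * (2 * p * K * b) <= a n `^ p + (2 * p * K * b) `^ p.
  set y := 2 * p * K * b; have y0 : 0 <= y by rewrite mulr_ge0.
  have [ya|/ltW ay] := leP y (a n).
    apply: (@le_trans _ _ (a n `^ p)); last by rewrite lerDl powR_ge0.
    by rewrite (powRpE (a0 n)) ler_wpM2l// powR_ge0.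
  apply: (@le_trans _ _ (y `^ p)); last by rewrite lerDr powR_ge0.
  rewrite (powRpE y0) ler_wpM2r//.
  by apply: ge0_ler_powR; rewrite ?nnegrE ?(ltW q0).
rewrite -powRM// -[\sum_(i < n) _]/(\sum_(i < n) w i * e i).
have : (\sum_(i < n) w i * (a n - a i)) * p <=
    (a n `^ (p - 1) * (K * b) + \sum_(i < n) w i * e i) * p.
  by rewrite ler_pM2r.
move: lower; rewrite ler_pdivrMr//; move: split_power.
move: (\sum_(i < n) w i * e i) (\sum_(i < n) w i * (a n - a i)) => S2 S1.
lra.
Qed.

End garsia.

(** * Measurability *)

(** These statements are applied both to the ambient sigma-algebra and, through
    [g_sigma_algebraType], to those of the filtration. *)
Section adapted_measurability.
Context d (T : measurableType d) (R : realType).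
Implicit Types X : nat -> T -> R.

Lemma measurable_max_fun X n : (forall j, (j <= n)%N -> measurable_fun setT (X j)) ->
  measurable_fun setT (max_fun X n).
Proof.
elim: n => [|n IHn] mX.
  by rewrite (_ : max_fun X 0 = cst 0) //; apply/funext => t; rewrite max_fun0.
rewrite (_ : max_fun X n.+1 = fun t => Num.max (max_fun X n t) `|X n.+1 t|); last first.
  by apply/funext => t; rewrite max_funS.
apply: measurable_maxr; first by apply: IHn => j jn; exact/mX/ltnW.
by apply: measurableT_comp; [exact: normr_measurable|exact: mX].
Qed.

Lemma measurable_increment X n : (forall j, (j <= n)%N -> measurable_fun setT (X j)) ->
  measurable_fun setT (increment X n).
Proof. by move=> mX; apply: measurable_funB; apply: mX => //; exact: leq_pred. Qed.

Lemma measurable_sqrt (f : T -> R) : measurable_fun setT f ->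
  measurable_fun setT (fun t => Num.sqrt (f t)).
Proof.
apply: measurableT_comp; apply: nondecreasing_measurable => //.
by move=> x y; exact: ler_wsqrtr.
Qed.

Lemma measurable_square_fun X n : (forall j, (j <= n)%N -> measurable_fun setT (X j)) ->
  measurable_fun setT (square_fun X n).
Proof.
move=> mX; apply: measurable_sqrt.
elim: n mX => [|n IHn] mX.
  by under eq_fun do rewrite big_nil; exact: measurable_cst.
under eq_fun do rewrite big_nat_recr//=.
apply: measurable_funD; first by apply: IHn => j jn; exact/mX/ltnW.
by apply: measurable_funX; apply: measurable_increment.
Qed.

Lemma measurable_radius X n : (forall j, (j <= n)%N -> measurable_fun setT (X j)) ->
  measurable_fun setT (path_radius X n).
Proof.
move=> mX; apply: measurable_sqrt; apply: measurable_funD; apply: measurable_funX.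
  exact: measurable_max_fun.
exact: measurable_square_fun.
Qed.

Lemma measurable_weight X n : (forall j, (j <= n)%N -> measurable_fun setT (X j)) ->
  measurable_fun setT (weight X n).
Proof.
(* The inverse is written as a power, whose measurability is known. *)
move=> mX; rewrite (_ : weight X n = fun t => X n t * path_radius X n t `^ (-1)).
  apply: measurable_funM; first exact: mX.
  exact: (measurableT_comp (measurable_powR (-1)) (measurable_radius mX)).
by apply/funext => t; rewrite powR_inv1// path_radius_ge0.
Qed.

Lemma measurable_restart X i l :
  (forall j, (j <= i + l)%N -> measurable_fun setT (X j)) ->
  forall j, (j <= l)%N -> measurable_fun setT (restart X i j).
Proof.
by move=> mX j jl; apply: measurable_funB; apply: mX; rewrite ?leq_addr ?leq_add2l.
Qed.

End adapted_measurability.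

(** * Integrals against functions measurable for a sub-sigma-algebra *)

Section sub_sigma_algebra.
Import HBNNSimple.
Context d (T : measurableType d) (R : realType) (P : probability T R).
Variable G : set (set T).
Hypotheses (sG : sigma_algebra setT G) (Gm : G `<=` measurable).

Let generatedE A : <<s G >> A -> G A.
Proof. by rewrite sigma_algebra_id. Qed.

Lemma measurable_wrt_measurable (f : T -> R) :
  measurable_wrt G f -> measurable_fun setT f.
Proof.
by move=> mf _ B mB; apply: Gm; apply: generatedE; exact: mf.
Qed.

Variables (D : T -> R).
Hypothesis iD : P.-integrable setT (EFin \o D).
Hypothesis D0 : forall A, G A -> (\int[P]_(t in A) (D t)%:E = 0)%E.

Let mD : measurable_fun setT D.
Proof. by apply/measurable_EFinP; exact: measurable_int iD. Qed.

Let indicDE (A : set T) : (fun t => (\1_A t * D t)%:E) = (EFin \o D) \_ A.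
Proof.
apply/funext => t; rewrite /patch indicE; case: ifPn => tA.
  by rewrite mul1r.
by rewrite mul0r.
Qed.

Let integrable_indicD (A : set T) : G A -> P.-integrable setT (fun t => (\1_A t * D t)%:E).
Proof.
move=> GA; rewrite indicDE; apply: (iffLR (integrable_mkcond _ (Gm GA))).
exact: (integrableS measurableT (Gm GA) (@subsetT _ A) iD).
Qed.

Let integral_sfun (f : {nnsfun (g_sigma_algebraType G) >-> R}) :
  (\int[P]_t (f t * D t)%:E = 0)%E.
Proof.
have Gf y : G (f @^-1` [set y]).
  by apply: generatedE; rewrite -[f @^-1` _]setTI; exact: (measurable_funP f).
have If y : P.-integrable setT (fun t => y%:E * (\1_(f @^-1` [set y]) t * D t)%:E)%E.
  by apply: integrableZl => //; exact: integrable_indicD.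
transitivity (\int[P]_t (\sum_(y <- finmap.enum_fset (fset_set (range f)))
    y%:E * (\1_(f @^-1` [set y]) t * D t)%:E))%E.
  apply: eq_integral => t _; rewrite sumEFin; congr EFin.
  rewrite {1}(fimfunE f t) fsbig_finite//= mulr_suml.
  by apply: eq_bigr => y _; rewrite mulrA.
rewrite integral_sum// big1_seq// => y _.
rewrite integralZl//; last exact: integrable_indicD.
by rewrite indicDE -integral_mkcond D0// mule0.
Qed.

Let integral_mul_nonneg (Z : T -> R) : measurable_wrt G Z -> (forall t, 0 <= Z t) ->
  P.-integrable setT (fun t => (Z t * D t)%:E) -> (\int[P]_t (Z t * D t)%:E = 0)%E.
Proof.
move=> mZ Z0 iZD.
have mZ' : measurable_fun (setT : set (g_sigma_algebraType G)) (EFin \o Z).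
  exact/measurable_EFinP.
pose f := nnsfun_approx measurableT mZ'.
have fm n : measurable_fun (setT : set T) (fun t : T => (f n t * D t)%:E).
  apply/measurable_EFinP; apply: measurable_funM => //.
  exact: (@measurable_wrt_measurable (f n) (measurable_funP (f n))).
have fZ t : f n t @[n --> \oo] --> Z t.
  have := cvg_nnsfun_approx measurableT mZ' (fun t _ => Z0 t) (I : setT t).
  by move/fine_cvg.
have f0 n t : 0 <= f n t by exact: fun_ge0.
have dom n t : `|f n t * D t| <= `|Z t * D t|.
  rewrite !normrM ler_wpM2r// (ger0_norm (Z0 t)) (ger0_norm (f0 n t)).
  rewrite -lee_fin /f nnsfun_approxE.
  exact: (@le_approx _ _ _ setT (EFin \o Z) n t (fun t _ => Z0 t) I).
have [||_ _] := @dominated_convergence _ T R P setT measurableT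
  (fun n t => (f n t * D t)%:E) (fun t => (Z t * D t)%:E)
  (abse \o (fun t => (Z t * D t)%:E)) fm (measurable_int _ iZD)
  _ (integrable_abse iZD).
- apply: aeW => t _; apply: cvg_EFin; first exact: nearW.
  by apply: cvgMl; exact: fZ.
- by apply: aeW => t n _; rewrite /= lee_fin.
under eq_fun do rewrite integral_sfun.
by move/cvg_lim => <- //; exact: lim_cst.
Qed.

(** The hypothesis on D says that its conditional expectation given G vanishes.
    The claim extends from indicators of G to simple functions by linearity, to
    nonnegative Z by dominated convergence with dominating function |Z D|, and
    to all Z by taking positive and negative parts. *)
Lemma integral_mul_measurable_wrt (Z : T -> R) : measurable_wrt G Z ->
  P.-integrable setT (fun t => (Z t * D t)%:E) -> (\int[P]_t (Z t * D t)%:E = 0)%E.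
Proof.
move=> mZ iZD.
have part (Y : T -> R) : measurable_wrt G Y -> (forall t, 0 <= Y t <= `|Z t|) ->
    P.-integrable setT (fun t => (Y t * D t)%:E) /\ (\int[P]_t (Y t * D t)%:E = 0)%E.
  move=> mY YZ.
  have iYD : P.-integrable setT (fun t => (Y t * D t)%:E).
    apply: (le_integrable measurableT _ _ iZD) => [|t _].
      apply/measurable_EFinP; apply: measurable_funM => //.
      exact: measurable_wrt_measurable.
    have /andP[Y0 YZt] := YZ t.
    by rewrite /= lee_fin !normrM ler_wpM2r// ger0_norm.
  by split => //; apply: integral_mul_nonneg => // t; case/andP: (YZ t).
have [|t|ip ip0] := part (Z^\+)%R; first exact: measurable_funrpos.
  by rewrite funrpos_ge0/= /funrpos ge_max ler_norm normr_ge0.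
have [|t|im im0] := part (Z^\-)%R; first exact: measurable_funrneg.
  by rewrite funrneg_ge0/= /funrneg ge_max ler_normr lexx orbT normr_ge0.
transitivity (\int[P]_t ((Z^\+ t * D t)%:E - (Z^\- t * D t)%:E))%E.
  apply: eq_integral => t _; rewrite -EFinB -mulrBl; congr (_ * _)%:E.
  by rewrite -[in LHS](funrposBneg Z).
by rewrite integralB// ip0 im0 sube0.
Qed.

End sub_sigma_algebra.

Lemma measurable_wrt_sub d (T : measurableType d) (R : realType)
    (G H : set (set T)) (Y : T -> R) :
  G `<=` H -> measurable_wrt G Y -> measurable_wrt H Y.
Proof.
by move=> GH mY _ B mB; apply: (sub_sigma_algebra2 GH); exact: mY.
Qed.


(** * Moments of martingales *)

Section martingale_transfer.
Context d (T : measurableType d) (R : realType) (P : probability T R).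
Variables (F : nat -> set (set T)) (X : nat -> T -> R).
Hypotheses (filtF : filtration F) (martX : martingale P F X) (X0 : X 0%N = cst 0).

Lemma filtration_homo i k : (1 <= i <= k)%N -> F i `<=` F k.
Proof.
move=> /andP[i1]; elim: k => [|k IHk]; first by case: i i1.
rewrite leq_eqVlt => /orP[/eqP->//|ik].
have /filtF[_ _ Fk] : (1 <= k)%N by exact: leq_trans i1 ik.
exact: subset_trans (IHk ik) Fk.
Qed.

Lemma martingale_measurable_wrt j k : (1 <= k)%N -> (j <= k)%N -> measurable_wrt (F k) (X j).
Proof.
move=> k1; case: j => [_|j jk]; first by rewrite X0; exact: measurable_cst.
have [mX _ _] := martX (ltn0Sn j).
by apply: measurable_wrt_sub mX; exact: filtration_homo.
Qed.

Lemma martingale_measurable j : measurable_fun setT (X j).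
Proof.
case: j => [|j]; first by rewrite X0; exact: measurable_cst.
have [_ iX _] := martX (ltn0Sn j).
by apply/measurable_EFinP; exact: measurable_int iX.
Qed.

Definition centered (f : T -> R) :=
  P.-integrable setT (EFin \o f) /\ (\int[P]_t (f t)%:E = 0)%E.

Lemma centered0 : centered (cst 0).
Proof. by split; [exact: integrable0|rewrite integral0_eq]. Qed.

Lemma centered_sum n (f : 'I_n -> T -> R) : (forall i, centered (f i)) ->
  centered (fun t => \sum_(i < n) f i t).
Proof.
move=> cf.
have sumE : EFin \o (fun t => \sum_(i < n) f i t) = (fun t => \sum_(i < n) (f i t)%:E)%E.
  by apply/funext => t; rewrite /= sumEFin.
split; first by rewrite sumE; apply: integrable_sum => // i _; exact: (cf i).1.
rewrite -[LHS]/(\int[P]_t (EFin \o (fun t => (\sum_(i < n) f i t)%R)) t)%E sumE.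
rewrite integral_sum//=; last by move=> i; exact: (cf i).1.
by rewrite big1// => i _; exact: (cf i).2.
Qed.

Lemma centered_transform k (Z : T -> R) : (1 <= k)%N -> measurable_wrt (F k) Z ->
  P.-integrable setT (EFin \o (fun t => Z t * increment X k.+1 t)) ->
  centered (fun t => Z t * increment X k.+1 t).
Proof.
move=> k1 mZ iZ; split => //.
have [sFk Fkm _] := filtF k1; have [_ iXk [_ _ Xk]] := martX k1.
have [_ iXk1 _] := martX (ltn0Sn k).
have iD : P.-integrable setT (EFin \o increment X k.+1).
  by rewrite (_ : EFin \o _ = (EFin \o X k.+1) \- (EFin \o X k))%E//; exact: integrableB.
apply: (integral_mul_measurable_wrt sFk Fkm iD) => // A FA.
have mA := Fkm _ FA.
have iA Y : P.-integrable setT Y -> P.-integrable A Y.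
  exact: (integrableS measurableT mA (@subsetT _ A)).
transitivity (\int[P]_(t in A) ((X k.+1 t)%:E - (X k t)%:E))%E; first exact: eq_integral.
rewrite integralB//; [|exact: iA|exact: iA].
rewrite Xk// subee//; exact: integrable_fin_num (iA _ iXk1).
Qed.

(** The probabilistic half of the proof, for either direction.  The domination of
    A n and of the increments by B makes every transform integrable as soon as
    B^p is, so that no localization is needed.  The factor g i 0 has to vanish:
    the weight A_(i+1)^(p-1) - A_i^(p-1) is known only from time i + 1 on, and
    must not meet the increment from i to i + 1. *)
Lemma moment_transfer (p K L : R) (n : nat) (A : nat -> T -> R) (B : T -> R)
    (g : nat -> nat -> T -> R) :
  1 < p -> 0 < K -> 0 <= L ->
  (forall t, A 0%N t = 0) ->
  (forall t, {homo A^~ t : i j / (i <= j)%N >-> i <= j}) ->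
  (forall j k, (1 <= k)%N -> (j <= k)%N -> measurable_wrt (F k) (A j)) ->
  measurable_fun setT (A n) -> measurable_fun setT B -> (forall t, 0 <= B t) ->
  (forall t, A n t <= L * B t) ->
  (forall j t, (0 < j <= n)%N -> `|increment X j t| <= 2 * B t) ->
  (forall i l, (1 <= l)%N -> measurable_wrt (F (i + l)%N) (g i l)) ->
  (forall i t, g i 0%N t = 0) ->
  (forall i l t, `|g i l t| <= 2) ->
  (forall i t, (i < n)%N -> A n t - A i t <=
     K * B t + \sum_(l < n - i) g i l t * increment X (i + l).+1 t) ->
  ('E_P[fun t => (A n t `^ p)%R] <=
    ((2 * p * K) `^ p)%:E * 'E_P[fun t => (B t `^ p)%R])%E.
Proof.
move=> p1 K0 L0 A00 Ahomo mA mAn mB B0 AB XB mg g0 g2 growth.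
have q0 : 0 < p - 1 by rewrite subr_gt0.
have p0 : 0 < p by exact: lt_trans p1.
have A0 i t : 0 <= A i t by rewrite -(A00 t) Ahomo.
pose C := (2 * p * K) `^ p.
have C0 : 0 < C by rewrite powR_gt0// !mulr_gt0.
have mBp : measurable_fun setT (fun t => B t `^ p).
  exact: (measurableT_comp (measurable_powR p) mB).
have mAp : measurable_fun setT (fun t => A n t `^ p).
  exact: (measurableT_comp (measurable_powR p) mAn).
rewrite unlock -/C.
have [Boo|] := eqVneq (\int[P]_t (B t `^ p)%:E)%E +oo%E.
  by rewrite Boo gt0_muley ?lte_fin// leey.
rewrite -ltey => Bfin.
have iB : P.-integrable setT (EFin \o (fun t => B t `^ p)).
  apply/integrableP; split; first exact/measurable_EFinP.
  rewrite (_ : integral _ _ _ = \int[P]_t (B t `^ p)%:E)%E//.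
  by apply: eq_integral => t _; rewrite /= ger0_norm// powR_ge0.
pose w i t := A i.+1 t `^ (p - 1) - A i t `^ (p - 1).
have wB i t : (i < n)%N -> `|w i t| <= L `^ (p - 1) * B t `^ (p - 1).
  move=> ni; rewrite -powRM//.
  have Aq j k : (j <= k)%N -> A j t `^ (p - 1) <= A k t `^ (p - 1).
    by move=> jk; apply: ge0_ler_powR; rewrite ?nnegrE ?(ltW q0)//; exact: Ahomo.
  rewrite ger0_norm ?subr_ge0 ?Aq//.
  apply: (@le_trans _ _ (A n t `^ (p - 1))).
    by apply: le_trans (Aq _ _ ni); rewrite gerBl powR_ge0.
  by apply: ge0_ler_powR; rewrite ?nnegrE ?(ltW q0)// mulr_ge0.
have centered_term i l : (i < n)%N -> (l < n - i)%N ->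
    centered (fun t => (w i t * g i l t) * increment X (i + l).+1 t).
  move=> ni lni; case: (posnP l) => [->|l0].
    under eq_fun do rewrite g0 mulr0 mul0r; exact: centered0.
  have il1 : (1 <= i + l)%N by rewrite addn_gt0 l0 orbT.
  have mwg : measurable_wrt (F (i + l)%N) (fun t => w i t * g i l t).
    apply: measurable_funM; last exact: mg.
    apply: measurable_funB.
      apply: (measurableT_comp (measurable_powR (p - 1))).
      by apply: mA => //; rewrite -addn1 leq_add2l.
    apply: (measurableT_comp (measurable_powR (p - 1))).
    by apply: mA => //; rewrite leq_addr.
  apply: centered_transform => //.
  have [sF Fm _] := filtF il1.
  have idom := integrableZl measurableT (L `^ (p - 1) * 4) iB.
  apply: (le_integrable measurableT _ _ idom) => [|t _].
    apply/measurable_EFinP; apply: measurable_funM.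
      exact: (measurable_wrt_measurable sF Fm mwg).
    by apply: measurable_increment => j _; exact: martingale_measurable.
  rewrite /= lee_fin !normrM.
  have -> : B t `^ p = B t `^ (p - 1) * B t.
    rewrite -{3}(powRr1 (B0 t)) -powRD ?subrK//.
    by rewrite (gt_eqF p0).
  have XBt : `|increment X (i + l).+1 t| <= 2 * B t.
    by apply: XB => /=; rewrite -ltn_subRL.
  rewrite normrM !(ger0_norm (powR_ge0 _ _)) (ger0_norm (B0 t)) (ger0_norm (ler0n _ 4)).
  apply: (@le_trans _ _ (L `^ (p - 1) * B t `^ (p - 1) * 2 * (2 * B t))).
    by rewrite ler_pM ?mulr_ge0// ler_pM// wB.
  by rewrite le_eqVlt; apply/orP; left; apply/eqP; ring.
pose M t := \sum_(i < n) w i t * \sum_(l < n - i) g i l t * increment X (i + l).+1 t.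
have [iM intM] : centered M.
  rewrite (_ : M = fun t => \sum_(i < n) \sum_(l < n - i)
      (w i t * g i l t) * increment X (i + l).+1 t).
    apply: centered_sum => i; apply: (@centered_sum _ (fun l t => _)) => l.
    exact: centered_term.
  apply/funext => t; apply: eq_bigr => i _; rewrite mulr_sumr.
  by apply: eq_bigr => l _; rewrite mulrA.
have iCB := integrableZl measurableT C iB.
have iM2 := integrableZl measurableT (2 * p) iM.
apply: (@le_trans _ _ (\int[P]_t (C%:E * (B t `^ p)%:E + (2 * p)%:E * (M t)%:E))%E).
  apply: ge0_le_integral => //.
  - by move=> t _; rewrite lee_fin powR_ge0.
  - exact/measurable_EFinP.
  - exact: measurable_int (integrableD measurableT iCB iM2).
  move=> t _; rewrite -!EFinM -EFinD lee_fin.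
  exact: (powR_growth p1 (A00 t) (Ahomo t) (B0 t) K0 (fun i => growth i t)).
by rewrite integralD// !integralZl// intM mule0 adde0.
Qed.

Lemma restart_measurable_wrt i l : (1 <= l)%N ->
  measurable_wrt (F (i + l)%N) (weight (restart X i) l).
Proof.
move=> l1; apply: measurable_weight; apply: measurable_restart => j jil.
by apply: martingale_measurable_wrt => //; rewrite addn_gt0 l1 orbT.
Qed.

Let X0t t : X 0%N t = 0. Proof. by rewrite X0. Qed.

Lemma weight_restart0 i t : weight (restart X i) 0 t = 0.
Proof. by rewrite /weight restart0 mul0r. Qed.

Lemma square_moment_le (p : R) n : 1 < p ->
  ('E_P[fun t => (square_fun X n t `^ p)%R] <=
    ((28 * p) `^ p)%:E * 'E_P[fun t => (max_fun X n t `^ p)%R])%E.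
Proof.
move=> p1; rewrite (_ : 28 * p = 2 * p * 14); last by ring.
have mX j (_ : (j <= n)%N) := martingale_measurable j.
apply: (@moment_transfer p 14 (n%:R * 2) n (square_fun X) (max_fun X n)
  (fun i l t => - weight (restart X i) l t)) => //.
- by move=> t; rewrite square_fun0.
- exact: square_fun_homo.
- move=> j k k1 jk; apply: measurable_square_fun => i ij.
  by apply: martingale_measurable_wrt => //; exact: leq_trans jk.
- exact: measurable_square_fun.
- exact: measurable_max_fun.
- exact: max_fun_ge0.
- by move=> t; rewrite -mulrA; apply: square_fun_le => j; exact: increment_le_max.
- by move=> j t; exact: increment_le_max.
- by move=> i l l1; apply: measurable_funN; exact: restart_measurable_wrt.
- by move=> i t; rewrite weight_restart0 oppr0.
- move=> i l t; rewrite normrN; apply: le_trans (weight_le1 _ (restart0 _ _ _)) _.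
  by rewrite ler1n.
- by move=> i t ni; apply: square_growth => //; exact: ltnW.
Qed.

Lemma max_moment_le (p : R) n : 1 < p ->
  ('E_P[fun t => (max_fun X n t `^ p)%R] <=
    ((22 * p) `^ p)%:E * 'E_P[fun t => (square_fun X n t `^ p)%R])%E.
Proof.
move=> p1; rewrite (_ : 22 * p = 2 * p * 11); last by ring.
have mX j (_ : (j <= n)%N) := martingale_measurable j.
apply: (@moment_transfer p 11 n%:R n (max_fun X) (square_fun X n)
  (fun i l t => 2 * weight (restart X i) l t)) => //.
- by move=> t; rewrite max_fun0.
- exact: max_fun_homo.
- move=> j k k1 jk; apply: measurable_max_fun => i ij.
  by apply: martingale_measurable_wrt => //; exact: leq_trans jk.
- exact: measurable_max_fun.
- exact: measurable_square_fun.
- exact: square_fun_ge0.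
- by move=> t; apply: max_fun_le => // j; exact: increment_le_square.
- move=> j t jn; apply: le_trans (increment_le_square _ _ jn) _.
  by rewrite ler_peMl ?square_fun_ge0// ler1n.
- move=> i l l1; apply: measurable_funM; first exact: measurable_cst.
  exact: restart_measurable_wrt.
- by move=> i t; rewrite weight_restart0 mulr0.
- move=> i l t; rewrite normrM ger0_norm//.
  by rewrite -[leRHS]mulr1 ler_wpM2l// weight_le1// restart0.
- by move=> i t ni; apply: max_growth => //; exact: ltnW.
Qed.

End martingale_transfer.

Theorem theorem1 (R : realType) (p : R) (hp : 1 < p) :
  exists c C : R, [/\ 0 < c, c <= C &
    forall (d : measure_display) (T : measurableType d) (P : probability T R)
           (F : nat -> set (set T)) (X : nat -> T -> R),
      filtration F -> martingale P F X -> X 0%N = cst 0 ->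
      forall n : nat, (1 <= n)%N ->
        ((c `^ p)%:E * 'E_P[fun t => (max_fun X n t `^ p)%R]
           <= 'E_P[fun t => (square_fun X n t `^ p)%R])%E /\
        ('E_P[fun t => (square_fun X n t `^ p)%R]
           <= (C `^ p)%:E * 'E_P[fun t => (max_fun X n t `^ p)%R])%E].
Proof.
have p0 : 0 < p by exact: lt_trans hp.
have K0 : 0 < 22 * p by rewrite mulr_gt0.
exists (22 * p)^-1, (28 * p); split; first by rewrite invr_gt0.
  apply: (@le_trans _ _ 1); last lra.
  by rewrite invf_le1//; lra.
move=> d T P F X filtF martX X0 n _; split; last exact: (square_moment_le filtF martX X0).
have Kp : 0 < (22 * p) `^ p by rewrite powR_gt0.
have -> : (22 * p)^-1 `^ p = ((22 * p) `^ p)^-1.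
  by rewrite -powR_inv1 ?ltW// -powRrM mulN1r powRN.
by rewrite lee_pdivrMl//; exact: (max_moment_le filtF martX X0).
Qed.
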